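(* Let $\alpha>0$. Let $(A(t),B(t))$, with $A(t)>0$ and $B(t)>0$, be the solution of the system $$\frac{dA}{dt}=-16\alpha\frac{A}{B^2},\qquad \frac{dB}{dt}=8-16\alpha\frac{1}{B},$$ with initial data $(A(0),B(0))=(A_0,B_0)$, $A_0>0$, $B_0>0$, defined on its maximal forward interval of existence $[0,t_{\max})$. (1) If $B_0>2\alpha$, then $t_{\max}=\infty$, and $B(t)\to\infty$ and $A(t)\to A_0\left(1-\frac{2\alpha}{B_0}\right)$ as $t\to\infty$. (2) If $B_0=2\alpha$, then $t_{\max}=\infty$, $B(t)=2\alpha$ for all $t>0$, and $A(t)\to0$ as $t\to\infty$. (3) If $B_0<2\alpha$, then $t_{\max}<\infty$, and $A(t)\to0$ and $B(t)\to0$ as $t\to t_{\max}$.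
   Context: The system is the second-order renormalization group (RG-2) flow $\partial_t g_{ij}=-2R_{ij}-\frac{\alpha}{2}R_{iklm}R_j{}^{klm}$, with coupling constant $\alpha>0$, restricted to homogeneous $\mathrm{Sol}$ metrics that are diagonal with components $(A,B,C)$ in a fixed left-invariant (Milnor) frame and satisfy the local rotational symmetry condition $A=C$. Solutions are considered in the open quarter plane $\{A>0,\,B>0\}$, and $[0,t_{\max})$, $0<t_{\max}\le\infty$, denotes the maximal interval on which the solution exists in that region. *)

(* Defs.v *)
From Stdlib Require Import Reals.
From Coquelicot Require Import Coquelicot.
Open Scope R_scope.

Definition forward_interval (T : Rbar) (t : R) : Prop :=
  0 <= t /\ Rbar_lt (Finite t) T.

(* [(A, B)] solves the RG-2 flow of locally rotationally symmetric Sol metrics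
   on [0, T), staying in the open quarter plane.  [D_in] is differentiability
   relative to [0, T): the ordinary two-sided derivative for 0 < t < T, the
   right derivative at t = 0.  The values of [A], [B] outside [0, T) are
   irrelevant. *)
Definition sol_rg2_solution (alpha : R) (T : Rbar) (A B : R -> R) : Prop :=
  forall t : R, forward_interval T t ->
    0 < A t /\ 0 < B t /\
    D_in A (fun s => -16 * alpha * (A s / B s ^ 2)) (forward_interval T) t /\
    D_in B (fun s => 8 - 16 * alpha * (1 / B s)) (forward_interval T) t.

(* [0, T) is the maximal forward interval of existence: the solution has no
   extension, inside the open quarter plane, to any [0, T') with T < T'. *)
Definition maximal_sol_rg2_solution
    (alpha : R) (T : Rbar) (A B : R -> R) : Prop :=
  sol_rg2_solution alpha T A B /\
  forall (T' : Rbar) (A' B' : R -> R),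
    Rbar_lt T T' ->
    (forall t : R, forward_interval T t -> A' t = A t /\ B' t = B t) ->
    ~ sol_rg2_solution alpha T' A' B'.

(* Main.v *)
Require Import Defs.
From Stdlib Require Import Reals.
From Stdlib Require Import Ranalysis5 Lra.
From Coquelicot Require Import Coquelicot.
Open Scope R_scope.

(** The scalar function [B] evolves by itself, and the equations integrate
    by quadratures.  Two exact relations carry the proof.

    - [A * (1 - 2 * alpha / B)] is constant along every solution
      ([first_integral]).  Since [A] and [B] are positive, the sign of
      [B - 2 * alpha] never changes, so the three cases of the theorem cannot
      mix.  The relation also determines [A] from [B] when
      [B <> 2 * alpha], and its constant is the limit of [A] when [B] tends
      to infinity.

    - Away from the equilibrium, put [u = ln |B - 2 * alpha|], so that
      [B = 2 * alpha + sg * exp u] with [sg] the sign of [B - 2 * alpha].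
      The equation for [B] becomes [u' = 8 / B], and therefore
      [flow_time u = (2 * alpha * u + sg * exp u) / 8] grows at unit speed
      along the solution ([flow_time_along_solution]).

    Conversely, [flow_time] is strictly increasing where [B > 0], and its
    inverse produces a solution for as long as the target time stays in the
    range of [flow_time] ([integral_curve]).  By the two relations this
    solution agrees with the given one, so a maximal solution lives at least
    that long ([maximal_time_lower_bound]).

    If [B 0 > 2 * alpha], then [flow_time] is unbounded above.  Hence the
    solution is global, and [ln x <= x] turns the implicit equation for [B]
    into a linear lower bound.  If [B 0 = 2 * alpha], the constant of the
    first integral is zero, which forces [B] to be constant and [A] to decay
    exponentially.  If [B 0 < 2 * alpha], then [B] reaches [0] when [u]
    reaches [ln (2 * alpha)].  The corresponding value of [flow_time] is
    finite; it gives the maximal time exactly, and the second-order contact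
    of [flow_time] with its maximum gives [B ^ 2 <= 32 * alpha * (T - t)]
    ([remaining_time_bound]), hence [B -> 0] and, by the first integral,
    [A -> 0]. *)

(** * Calculus on a half-open interval *)

Lemma forward_interval_0 (T : Rbar) (t : R) :
  forward_interval T t -> forward_interval T 0.
Proof.
intros [Ht0 HtT]; split; [lra |].
apply Rbar_le_lt_trans with (2 := HtT); exact Ht0.
Qed.

(** Continuing [f] to the left of [0] by its tangent line turns the one-sided
    derivative at [0] into a two-sided one, so that the usual rules of
    differentiation and the mean value theorem apply up to the initial
    time. *)
Lemma D_in_two_sided_extension (f df : R -> R) (T : Rbar) :
  (forall t, forward_interval T t -> D_in f df (forward_interval T) t) ->
  exists g : R -> R,
    forall t, forward_interval T t -> g t = f t /\ is_derive g t (df t).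
Proof.
intros Hf.
exists (fun s => if Rlt_dec s 0 then f 0 + df 0 * s else f s).
intros t [Ht0 HtT].
split; [destruct (Rlt_dec t 0); lra |].
apply is_derive_Reals; intros eps Heps.
destruct (Hf t (conj Ht0 HtT) eps Heps) as [d [Hd Hlim]].
(* A step shorter than [r] does not leave the interval on the right. *)
assert (Hroom : exists r, 0 < r /\ forall h, h < r -> Rbar_lt (t + h) T).
{ destruct T as [T | |]; simpl in HtT |- *.
  - exists (T - t); split; [lra | intros h Hh; lra].
  - exists 1; split; [lra | trivial].
  - contradiction. }
destruct Hroom as [r [Hr Hroom]].
(* For [t > 0] the step must also be shorter than [t], so that only [f] is
   seen; at [t = 0] the affine piece has difference quotient exactly
   [df 0]. *)
assert (Hm : 0 < Rmin (Rmin d r) (if Rlt_dec 0 t then t else 1)).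
{ repeat apply Rmin_pos; try lra; destruct (Rlt_dec 0 t); lra. }
exists (mkposreal _ Hm); simpl; intros h Hh0 Hh.
assert (Hhd : Rabs h < d).
{ eapply Rlt_le_trans; [exact Hh |].
  eapply Rle_trans; [apply Rmin_l | apply Rmin_l]. }
assert (Hhr : Rabs h < r).
{ eapply Rlt_le_trans; [exact Hh |].
  eapply Rle_trans; [apply Rmin_l | apply Rmin_r]. }
assert (Hht : Rabs h < if Rlt_dec 0 t then t else 1).
{ eapply Rlt_le_trans; [exact Hh | apply Rmin_r]. }
apply Rabs_def2 in Hhr.
destruct (Rlt_dec t 0) as [Hc | _]; [lra |].
destruct (Rlt_dec (t + h) 0) as [Hneg | Hpos].
- assert (Ht : t = 0).
  { destruct (Rlt_dec 0 t) as [Hp | Hp]; [| lra].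
    apply Rabs_def2 in Hht; lra. }
  subst t.
  replace ((f 0 + df 0 * (0 + h) - f 0) / h - df 0) with 0 by (field; exact Hh0).
  rewrite Rabs_R0; exact Heps.
- specialize (Hlim (t + h)); simpl in Hlim; unfold R_dist, D_x in Hlim.
  replace (t + h - t) with h in Hlim by ring.
  apply Hlim; split; [| exact Hhd].
  split; [| intro E; apply Hh0; lra].
  split; [lra | apply Hroom; lra].
Qed.

Lemma is_derive_D_in (f df : R -> R) (D : R -> Prop) (x : R) :
  is_derive f x (df x) -> D_in f df D x.
Proof.
intros Hf.
apply is_derive_Reals, derivable_pt_lim_D_in in Hf.
intros eps Heps.
destruct (Hf eps Heps) as [d [Hd Hlim]].
exists d; split; [exact Hd |].
intros y [[_ Hy] Hdist]; apply Hlim; split; [| exact Hdist].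
split; [exact I | exact Hy].
Qed.

Lemma constant_on_forward_interval (f : R -> R) (T : Rbar) :
  (forall t, forward_interval T t -> is_derive f t 0) ->
  forall t, forward_interval T t -> f t = f 0.
Proof.
intros Hf t [Ht0 HtT].
destruct (Req_dec t 0) as [-> | Hne]; [reflexivity |].
symmetry; apply (eq_is_derive f 0 t); [| lra].
intros s Hs; apply Hf; split; [lra |].
apply Rbar_le_lt_trans with (2 := HtT); simpl; lra.
Qed.

(** The intermediate value theorem supplies the inverse and monotonicity its
    continuity.  The endpoints [F a] and [F b] are left out because [g] is
    arbitrary outside the range of [F], hence one-sided at them. *)
Lemma increasing_inverse (F f : R -> R) (a b : R) :
  a < b ->
  (forall x, a <= x <= b -> is_derive F x (f x)) ->
  (forall x, a <= x <= b -> 0 < f x) ->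
  exists g : R -> R,
    forall y, F a < y < F b ->
      a <= g y <= b /\ F (g y) = y /\ is_derive g y (/ f (g y)).
Proof.
intros Hab HF Hf.
assert (Hincr : forall x y, a <= x -> x < y -> y <= b -> F x < F y).
{ intros x y Hx Hxy Hy.
  apply (incr_function_le F x y f); simpl; try lra; intros z H1 H2;
    [apply HF | apply Hf]; lra. }
assert (Hcont : forall x, a <= x <= b -> continuity_pt F x).
{ intros x Hx; apply derivable_continuous_pt.
  exists (f x); apply is_derive_Reals, HF, Hx. }
assert (Hinv : forall y, {x | F a <= y <= F b -> a <= x <= b /\ F x = y}).
{ intros y.
  destruct (Rle_dec (F a) y) as [H1 | H1]; [| exists a; lra].
  destruct (Rle_dec y (F b)) as [H2 | H2]; [| exists a; lra].
  destruct (f_interv_is_interv F a b y Hab (conj H1 H2) Hcont) as [x Hx].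
  exists x; auto. }
set (g := fun y => proj1_sig (Hinv y)).
assert (Hg : forall y, F a <= y <= F b -> a <= g y <= b /\ F (g y) = y).
{ intros y Hy; exact (proj2_sig (Hinv y) Hy). }
assert (Hgle : forall y z, F a <= y -> y <= z -> z <= F b -> g y <= g z).
{ intros y z Hy Hyz Hz.
  destruct (Hg y) as [Hy1 Hy2]; [lra |].
  destruct (Hg z) as [Hz1 Hz2]; [lra |].
  destruct (Rle_lt_dec (g y) (g z)) as [Hle | Hlt]; [exact Hle |].
  assert (F (g z) < F (g y)) by (apply Hincr; lra); lra. }
exists g; intros y Hy.
destruct (Hg y) as [Hgy1 Hgy2]; [lra |].
split; [exact Hgy1 | split; [exact Hgy2 |]].
assert (HFab : F a < F b) by lra.
assert (Hga : a <= g (F a) <= b) by (apply Hg; lra).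
assert (Hgb : a <= g (F b) <= b) by (apply Hg; lra).
assert (Prf : forall x, g (F a) <= x <= g (F b) -> derivable_pt F x).
{ intros x Hx; exists (f x); apply is_derive_Reals, HF; lra. }
assert (Hgy : g (F a) <= g y <= g (F b)) by (split; apply Hgle; lra).
assert (Hd : derive_pt F (g y) (Prf (g y) Hgy) = f (g y)).
{ apply derive_pt_eq_0, is_derive_Reals, HF, Hgy1. }
apply is_derive_Reals.
replace (/ f (g y)) with (1 / derive_pt F (g y) (Prf (g y) Hgy))
  by (rewrite Hd; unfold Rdiv; ring).
apply (derivable_pt_lim_recip_interv F g (F a) (F b)); try lra.
- apply (continuity_pt_recip_interv F g a b Hab Hincr).
  + intros x H1 H2; exact (proj2 (Hg x (conj H1 H2))).
  + intros x H1 H2; exact (proj1 (Hg x (conj H1 H2))).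
  + exact Hcont.
  + exact Hy.
- intros x Hx; apply Hg, Hx.
- rewrite Hd; apply Rgt_not_eq, Hf, Hgy1.
Qed.

(** * Conservation laws *)

(** Here [A' / A = -16 * alpha / B ^ 2], and the logarithmic derivative of
    [1 - 2 * alpha / B] is [2 * alpha * B' / (B * (B - 2 * alpha))], which is
    [16 * alpha / B ^ 2]: they cancel.  The identity also covers
    [B = 2 * alpha], where no logarithm is available. *)
Lemma first_integral (alpha : R) (T : Rbar) (A B : R -> R) :
  sol_rg2_solution alpha T A B ->
  forall t, forward_interval T t ->
    A t * (1 - 2 * alpha / B t) = A 0 * (1 - 2 * alpha / B 0).
Proof.
intros Hsol t Ht.
destruct (D_in_two_sided_extension A _ T (fun s Hs =>
  proj1 (proj2 (proj2 (Hsol s Hs))))) as [A1 HA].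
destruct (D_in_two_sided_extension B _ T (fun s Hs =>
  proj2 (proj2 (proj2 (Hsol s Hs))))) as [B1 HB].
pose proof (forward_interval_0 T t Ht) as H0.
rewrite <- (proj1 (HA t Ht)), <- (proj1 (HB t Ht)).
rewrite <- (proj1 (HA 0 H0)), <- (proj1 (HB 0 H0)).
apply (constant_on_forward_interval
  (fun s => A1 s * (1 - 2 * alpha / B1 s)) T); [| exact Ht].
intros s Hs.
destruct (HA s Hs) as [HAs DA]; destruct (HB s Hs) as [HBs DB].
destruct (Hsol s Hs) as [_ [Bpos _]].
auto_derive.
- repeat split; try (eexists; eassumption); rewrite HBs; lra.
- change (Derive (fun x => A1 x) s) with (Derive A1 s).
  change (Derive (fun x => B1 x) s) with (Derive B1 s).
  rewrite (is_derive_unique _ _ _ DA), (is_derive_unique _ _ _ DB), HAs, HBs.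
  field; lra.
Qed.

(** Up to an additive constant, the time that the flow takes to reach
    [B = 2 * alpha + sg * exp u], where [sg] is the sign of [B - 2 * alpha]:
    a primitive of [1 / u' = B / 8]. *)
Definition flow_time (alpha sg u : R) : R := (2 * alpha * u + sg * exp u) / 8.

Lemma is_derive_flow_time (alpha sg u : R) :
  is_derive (flow_time alpha sg) u ((2 * alpha + sg * exp u) / 8).
Proof. unfold flow_time; auto_derive; [trivial | field]. Qed.

(** The set of [u] with [B > 0] is unbounded to the left: the whole line for
    [sg = 1], and the half-line [u < ln (2 * alpha)] for [sg = -1]. *)
Lemma flow_time_domain_le (alpha sg u v : R) :
  0 < alpha -> sg = 1 \/ sg = -1 -> u <= v ->
  0 < 2 * alpha + sg * exp v -> 0 < 2 * alpha + sg * exp u.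
Proof.
intros Ha [-> | ->] Huv Hv; pose proof (exp_pos u) as Hu; [lra |].
assert (exp u <= exp v); [| lra].
destruct Huv as [Huv | ->]; [left; apply exp_increasing, Huv | lra].
Qed.

Lemma flow_time_increasing (alpha sg u v : R) :
  0 < alpha -> sg = 1 \/ sg = -1 -> u < v ->
  0 < 2 * alpha + sg * exp v -> flow_time alpha sg u < flow_time alpha sg v.
Proof.
intros Ha Hsg Huv Hv.
apply (incr_function_le _ u v (fun x => (2 * alpha + sg * exp x) / 8));
  simpl; try lra.
- intros x _ _; apply is_derive_flow_time.
- intros x _ Hx.
  pose proof (flow_time_domain_le alpha sg x v Ha Hsg Hx Hv); lra.
Qed.

Lemma flow_time_inj (alpha sg u v : R) :
  0 < alpha -> sg = 1 \/ sg = -1 ->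
  0 < 2 * alpha + sg * exp u -> 0 < 2 * alpha + sg * exp v ->
  flow_time alpha sg u = flow_time alpha sg v -> u = v.
Proof.
intros Ha Hsg Hu Hv E.
destruct (Rtotal_order u v) as [H | [H | H]]; [| exact H |].
- pose proof (flow_time_increasing alpha sg u v Ha Hsg H Hv); lra.
- pose proof (flow_time_increasing alpha sg v u Ha Hsg H Hu); lra.
Qed.

(** The first integral has the sign of [B - 2 * alpha], because [A / B] is
    positive. *)
Lemma side_preserved (alpha sg : R) (T : Rbar) (A B : R -> R) :
  sg = 1 \/ sg = -1 ->
  sol_rg2_solution alpha T A B ->
  0 < sg * (B 0 - 2 * alpha) ->
  forall t, forward_interval T t -> 0 < sg * (B t - 2 * alpha).
Proof.
intros Hsg Hsol Hside t Ht.
pose proof (forward_interval_0 T t Ht) as H0.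
destruct (Hsol t Ht) as [At [Bt _]].
destruct (Hsol 0 H0) as [A0 [B0 _]].
pose proof (first_integral alpha T A B Hsol t Ht) as HI.
assert (E : forall a b, 0 < b ->
  sg * (b - 2 * alpha) * (a / b) = sg * (a * (1 - 2 * alpha / b))).
{ intros a b Hb; field; lra. }
assert (Hp : 0 < sg * (B t - 2 * alpha) * (A t / B t)).
{ rewrite (E _ _ Bt), HI, <- (E _ _ B0).
  apply Rmult_lt_0_compat; [exact Hside | apply Rdiv_lt_0_compat; assumption]. }
apply Rmult_lt_reg_r with (A t / B t).
- apply Rdiv_lt_0_compat; assumption.
- lra.
Qed.

(** With [u = ln (sg * (B - 2 * alpha))], the chain rule gives
    [(B / 8) * u' = (B / 8) * (8 / B) = 1]. *)
Lemma flow_time_along_solution (alpha sg : R) (T : Rbar) (A B : R -> R) :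
  sg = 1 \/ sg = -1 ->
  sol_rg2_solution alpha T A B ->
  0 < sg * (B 0 - 2 * alpha) ->
  forall t, forward_interval T t ->
    flow_time alpha sg (ln (sg * (B t - 2 * alpha))) =
    t + flow_time alpha sg (ln (sg * (B 0 - 2 * alpha))).
Proof.
intros Hsg Hsol Hside t Ht.
destruct (D_in_two_sided_extension B _ T (fun s Hs =>
  proj2 (proj2 (proj2 (Hsol s Hs))))) as [B1 HB].
pose proof (forward_interval_0 T t Ht) as H0.
rewrite <- (proj1 (HB t Ht)), <- (proj1 (HB 0 H0)).
enough (E : flow_time alpha sg (ln (sg * (B1 t - 2 * alpha))) - t =
  flow_time alpha sg (ln (sg * (B1 0 - 2 * alpha))) - 0) by lra.
apply (constant_on_forward_interval
  (fun s => flow_time alpha sg (ln (sg * (B1 s - 2 * alpha))) - s) T);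
  [| exact Ht].
intros s Hs.
destruct (HB s Hs) as [HBs DB].
destruct (Hsol s Hs) as [_ [Bpos _]].
pose proof (side_preserved alpha sg T A B Hsg Hsol Hside s Hs) as Hss.
rewrite <- HBs in Hss.
unfold flow_time; auto_derive.
- repeat split; try (eexists; eassumption); exact Hss.
- change (Derive (fun x => B1 x) s) with (Derive B1 s).
  rewrite (is_derive_unique _ _ _ DB).
  change (B1 s + - (2 * alpha)) with (B1 s - 2 * alpha).
  rewrite exp_ln by exact Hss.
  rewrite HBs in *.
  destruct Hsg as [-> | ->]; field; split; lra.
Qed.

(** * Explicit solutions and the length of life *)

(** The component [A] is [k * B / (B - 2 * alpha)] written in terms of [u],
    with [k] the value of the first integral.  The solution starts at [u0]
    and stops when [u] reaches [b]. *)
Lemma integral_curve (alpha sg k u0 b : R) :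
  0 < alpha -> sg = 1 \/ sg = -1 -> 0 < sg * k -> u0 < b ->
  0 < 2 * alpha + sg * exp b ->
  exists u : R -> R,
    sol_rg2_solution alpha (flow_time alpha sg b - flow_time alpha sg u0)
      (fun t => k * (1 + sg * (2 * alpha) * exp (- u t)))
      (fun t => 2 * alpha + sg * exp (u t)) /\
    forall t,
      forward_interval (flow_time alpha sg b - flow_time alpha sg u0) t ->
      flow_time alpha sg (u t) = t + flow_time alpha sg u0.
Proof.
intros Ha Hsg Hk Hu0b Hb.
assert (Hdom : forall x, x <= b -> 0 < 2 * alpha + sg * exp x).
{ intros x Hx; apply (flow_time_domain_le alpha sg x b); assumption. }
(* Starting the inverse at [u0 - 1] makes [flow_time u0] an interior point
   of its domain, so that the curve is differentiable at time [0]. *)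
destruct (increasing_inverse (flow_time alpha sg)
  (fun x => (2 * alpha + sg * exp x) / 8) (u0 - 1) b) as [g Hg]; [lra | | |].
- intros x _; apply is_derive_flow_time.
- intros x Hx; pose proof (Hdom x (proj2 Hx)); lra.
- assert (Hrange : forall t,
    forward_interval (flow_time alpha sg b - flow_time alpha sg u0) t ->
    flow_time alpha sg (u0 - 1) < t + flow_time alpha sg u0
      < flow_time alpha sg b).
  { intros t [Ht0 HtT]; simpl in HtT.
    assert (flow_time alpha sg (u0 - 1) < flow_time alpha sg u0); [| lra].
    apply flow_time_increasing; try assumption; [lra | apply Hdom; lra]. }
  set (u := fun t => g (t + flow_time alpha sg u0)).
  exists u.
  split; [| intros t Ht; apply (Hg _ (Hrange t Ht))].
  intros t Ht.
  destruct (Hg _ (Hrange t Ht)) as [Hgb [_ Dg]].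
  fold (u t) in Hgb, Dg.
  pose proof (Hdom (u t) (proj2 Hgb)) as HBpos.
  pose proof (exp_pos (u t)) as Hexp.
  assert (Du : is_derive u t (8 / (2 * alpha + sg * exp (u t)))).
  { unfold u at 1; auto_derive.
    - eexists; exact Dg.
    - change (Derive (fun x => g x)) with (Derive g).
      rewrite (is_derive_unique _ _ _ Dg); field; lra. }
  assert (HA : k * (1 + sg * (2 * alpha) * exp (- u t)) =
    sg * k * (2 * alpha + sg * exp (u t)) / exp (u t)).
  { rewrite exp_Ropp; destruct Hsg as [-> | ->]; field; lra. }
  split; [| split; [exact HBpos | split]].
  + rewrite HA; apply Rdiv_lt_0_compat; [| exact Hexp].
    apply Rmult_lt_0_compat; assumption.
  + apply is_derive_D_in.
    rewrite HA.
    auto_derive; [eexists; exact Du |].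
    change (Derive (fun x => u x)) with (Derive u).
    rewrite (is_derive_unique _ _ _ Du), exp_Ropp; field; lra.
  + apply is_derive_D_in.
    auto_derive; [eexists; exact Du |].
    change (Derive (fun x => u x)) with (Derive u).
    rewrite (is_derive_unique _ _ _ Du); field; lra.
Qed.

(** Were the maximal time shorter than the time needed to reach [b], the
    explicit solution would extend the given one: on the common interval both
    have the same [flow_time], hence the same [B], and the first integral
    then gives the same [A]. *)
Lemma maximal_time_lower_bound
    (alpha sg : R) (T : Rbar) (A B : R -> R) (b : R) :
  0 < alpha -> sg = 1 \/ sg = -1 -> Rbar_lt 0 T ->
  maximal_sol_rg2_solution alpha T A B ->
  0 < sg * (B 0 - 2 * alpha) ->
  ln (sg * (B 0 - 2 * alpha)) < b ->
  0 < 2 * alpha + sg * exp b ->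
  Rbar_le (flow_time alpha sg b -
           flow_time alpha sg (ln (sg * (B 0 - 2 * alpha)))) T.
Proof.
intros Ha Hsg HT [Hsol Hmax] Hside Hu0b Hb.
set (u0 := ln (sg * (B 0 - 2 * alpha))) in *.
set (k := A 0 * (1 - 2 * alpha / B 0)).
assert (H0 : forward_interval T 0) by (split; [lra | exact HT]).
destruct (Hsol 0 H0) as [A0pos [B0pos _]].
assert (Hk : 0 < sg * k).
{ unfold k.
  replace (sg * (A 0 * (1 - 2 * alpha / B 0)))
    with (sg * (B 0 - 2 * alpha) * (A 0 / B 0)) by (field; lra).
  apply Rmult_lt_0_compat; [exact Hside | apply Rdiv_lt_0_compat; assumption]. }
destruct (integral_curve alpha sg k u0 b) as [u [Hu Hut]]; try assumption.
apply Rbar_not_lt_le; intros Hlt.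
apply (Hmax _ _ _ Hlt) in Hu; [exact Hu |].
intros t Ht.
assert (Ht' : forward_interval
  (flow_time alpha sg b - flow_time alpha sg u0) t).
{ split; [apply Ht |].
  apply Rbar_lt_trans with (2 := Hlt); apply Ht. }
pose proof (side_preserved alpha sg T A B Hsg Hsol Hside t Ht) as Hst.
destruct (Hsol t Ht) as [Apos [Bpos _]].
destruct (Hu t Ht') as [_ [Bupos _]].
assert (HBt : sg * exp (ln (sg * (B t - 2 * alpha))) = B t - 2 * alpha).
{ rewrite exp_ln by exact Hst; destruct Hsg as [-> | ->]; ring. }
assert (E : u t = ln (sg * (B t - 2 * alpha))).
{ apply (flow_time_inj alpha sg); try assumption.
  - rewrite HBt; lra.
  - rewrite (Hut t Ht').
    symmetry; apply (flow_time_along_solution alpha sg T A B); assumption. }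
rewrite E, HBt; split; [| ring].
rewrite exp_Ropp, exp_ln by exact Hst.
unfold k; rewrite <- (first_integral alpha T A B Hsol t Ht).
destruct Hsg as [-> | ->]; field; split; lra.
Qed.

(** * The three regimes *)

Lemma expanding_case (alpha : R) (T : Rbar) (A B : R -> R) :
  0 < alpha -> Rbar_lt 0 T ->
  maximal_sol_rg2_solution alpha T A B ->
  2 * alpha < B 0 ->
  T = p_infty /\ is_lim B p_infty p_infty /\
  is_lim A p_infty (A 0 * (1 - 2 * alpha / B 0)).
Proof.
intros Ha HT Hmax Hside.
assert (Hsg : 1 = 1 \/ 1 = -1) by (left; reflexivity).
assert (Hside1 : 0 < 1 * (B 0 - 2 * alpha)) by lra.
set (u0 := ln (1 * (B 0 - 2 * alpha))).
assert (ET : T = p_infty).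
{ destruct T as [T | |]; [| reflexivity | contradiction].
  exfalso; simpl in HT.
  set (y := T + flow_time alpha 1 u0).
  (* Since [flow_time b > alpha * b / 4], the value [4 * y / alpha] already
     puts [flow_time b] above [y]. *)
  set (b := Rmax (u0 + 1) (4 * y / alpha)).
  pose proof (exp_pos b) as Hexp.
  assert (Hb : Rbar_le (flow_time alpha 1 b - flow_time alpha 1 u0) T).
  { apply (maximal_time_lower_bound alpha 1 T A B); try assumption; [| lra].
    pose proof (Rmax_l (u0 + 1) (4 * y / alpha)) as H; fold b in H; fold u0; lra. }
  simpl in Hb.
  assert (Hyb : 4 * y <= alpha * b).
  { replace (4 * y) with (alpha * (4 * y / alpha)) by (field; lra).
    apply Rmult_le_compat_l; [lra | apply Rmax_r]. }
  assert (Hy : y < flow_time alpha 1 b) by (unfold flow_time; lra).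
  unfold y in Hy; lra. }
split; [exact ET |]; subst T.
destruct Hmax as [Hsol _].
assert (HB : is_lim B p_infty p_infty).
{ apply (is_lim_le_p_loc
    (fun t => 8 / (1 + 2 * alpha) * (t + flow_time alpha 1 u0))).
  - exists 0; intros t Ht.
    assert (Hft : forward_interval p_infty t) by (split; [lra | exact I]).
    pose proof (side_preserved alpha 1 _ A B Hsg Hsol Hside1 t Hft) as Hst.
    unfold u0.
    rewrite <- (flow_time_along_solution alpha 1 _ A B Hsg Hsol Hside1 t Hft).
    unfold flow_time; rewrite exp_ln by exact Hst.
    (* Replacing the logarithm by [B] in [8 * flow_time] bounds it by
       [(1 + 2 * alpha) * B]. *)
    assert (Hln : ln (1 * (B t - 2 * alpha)) <= B t).
    { pose proof (exp_ineq1_le (ln (1 * (B t - 2 * alpha)))) as H.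
      rewrite exp_ln in H by exact Hst; lra. }
    apply Rmult_le_reg_l with (1 + 2 * alpha); [lra |].
    set (l := ln (1 * (B t - 2 * alpha))) in *.
    replace ((1 + 2 * alpha) * (8 / (1 + 2 * alpha) *
      ((2 * alpha * l + 1 * (1 * (B t - 2 * alpha))) / 8)))
      with (2 * alpha * l + (B t - 2 * alpha)) by (field; lra).
    assert (2 * alpha * l <= 2 * alpha * B t)
      by (apply Rmult_le_compat_l; lra).
    lra.
  - apply is_lim_ext with
      (fun t => 8 / (1 + 2 * alpha) * t +
                8 / (1 + 2 * alpha) * flow_time alpha 1 u0);
      [intros; ring |].
    eapply is_lim_plus.
    + apply is_lim_scal_l, is_lim_id.
    + apply is_lim_const.
    + assert (Hp : 0 < 8 / (1 + 2 * alpha)) by (apply Rdiv_lt_0_compat; lra).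
      simpl; destruct (Rle_dec 0 (8 / (1 + 2 * alpha))) as [H | H]; [| lra].
      destruct (Rle_lt_or_eq_dec _ _ H); [reflexivity | lra]. }
split; [exact HB |].
set (k := A 0 * (1 - 2 * alpha / B 0)).
apply is_lim_ext_loc with (fun t => k + k * (2 * alpha) * / (B t - 2 * alpha)).
- exists 0; intros t Ht.
  assert (Hft : forward_interval p_infty t) by (split; [lra | exact I]).
  pose proof (side_preserved alpha 1 _ A B Hsg Hsol Hside1 t Hft) as Hst.
  unfold k; rewrite <- (first_integral alpha _ A B Hsol t Hft); field; lra.
- replace (Finite k) with (Finite (k + k * (2 * alpha) * 0)) by (f_equal; ring).
  apply is_lim_plus'; [apply is_lim_const |].
  apply (is_lim_scal_l (fun t => / (B t - 2 * alpha)) (k * (2 * alpha)) p_infty 0).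
  apply (is_lim_inv (fun t => B t - 2 * alpha) p_infty p_infty); [| discriminate].
  eapply is_lim_minus; [exact HB | apply is_lim_const | reflexivity].
Qed.

(** At [B 0 = 2 * alpha] the first integral vanishes, and positivity of [A]
    forces its other factor to vanish at all times; [A] then solves a linear
    equation with the constant rate [-16 * alpha / (2 * alpha) ^ 2]. *)
Lemma stationary_solution (alpha : R) (T : Rbar) (A B : R -> R) :
  sol_rg2_solution alpha T A B -> B 0 = 2 * alpha -> 0 < alpha ->
  forall t, forward_interval T t ->
    B t = 2 * alpha /\ A t = A 0 * exp (- 4 / alpha * t).
Proof.
intros Hsol HB0 Ha.
assert (HB : forall t, forward_interval T t -> B t = 2 * alpha).
{ intros t Ht.
  destruct (Hsol t Ht) as [Apos [Bpos _]].
  pose proof (first_integral alpha T A B Hsol t Ht) as HI.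
  rewrite HB0 in HI.
  replace (1 - 2 * alpha / (2 * alpha)) with 0 in HI by (field; lra).
  rewrite Rmult_0_r in HI.
  apply Rmult_integral in HI; destruct HI as [HI | HI]; [lra |].
  replace (2 * alpha) with (B t * (2 * alpha / B t)) by (field; lra).
  replace (2 * alpha / B t) with 1 by lra; ring. }
intros t Ht; split; [apply HB, Ht |].
destruct (D_in_two_sided_extension A _ T (fun s Hs =>
  proj1 (proj2 (proj2 (Hsol s Hs))))) as [A1 HA].
pose proof (forward_interval_0 T t Ht) as H0.
assert (E : A1 t * exp (4 / alpha * t) = A1 0 * exp (4 / alpha * 0)).
{ apply (constant_on_forward_interval
    (fun s => A1 s * exp (4 / alpha * s)) T); [| exact Ht].
  intros s Hs.
  destruct (HA s Hs) as [HAs DA].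
  auto_derive; [eexists; exact DA |].
  change (Derive (fun x => A1 x)) with (Derive A1).
  rewrite (is_derive_unique _ _ _ DA), (HB s Hs), HAs; field; lra. }
rewrite (proj1 (HA t Ht)), (proj1 (HA 0 H0)), Rmult_0_r, exp_0, Rmult_1_r in E.
rewrite <- E, Rmult_assoc, <- exp_plus.
replace (4 / alpha * t + - 4 / alpha * t) with 0 by (field; lra).
rewrite exp_0; ring.
Qed.

Lemma stationary_case (alpha : R) (T : Rbar) (A B : R -> R) :
  0 < alpha -> Rbar_lt 0 T ->
  maximal_sol_rg2_solution alpha T A B ->
  B 0 = 2 * alpha ->
  T = p_infty /\ (forall t, 0 < t -> B t = 2 * alpha) /\ is_lim A p_infty 0.
Proof.
intros Ha HT [Hsol Hmax] HB0.
pose proof (stationary_solution alpha T A B Hsol HB0 Ha) as Hform.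
assert (H0 : forward_interval T 0) by (split; [lra | exact HT]).
destruct (Hsol 0 H0) as [A0pos _].
assert (ET : T = p_infty).
{ destruct T as [T | |]; [| reflexivity | contradiction].
  exfalso.
  apply (Hmax p_infty (fun t => A 0 * exp (- 4 / alpha * t))
    (fun _ => 2 * alpha)).
  - exact I.
  - intros t Ht; destruct (Hform t Ht) as [-> ->]; split; reflexivity.
  - intros t _; split; [| split; [lra | split]].
    + apply Rmult_lt_0_compat; [exact A0pos | apply exp_pos].
    + apply is_derive_D_in; auto_derive; [trivial | field; lra].
    + apply is_derive_D_in; auto_derive; [trivial | field; lra]. }
subst T; split; [reflexivity | split].
- intros t Ht; apply Hform; split; [lra | exact I].
- apply is_lim_ext_loc with (fun t => A 0 * exp (- 4 / alpha * t)).
  + exists 0; intros t Ht; symmetry; apply Hform; split; [lra | exact I].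
  + replace (Finite 0) with (Rbar_mult (A 0) 0) by (simpl; f_equal; ring).
    apply is_lim_scal_l.
    apply (is_lim_comp exp (fun t => - 4 / alpha * t) p_infty 0 m_infty).
    * apply is_lim_exp_m.
    * replace m_infty with (Rbar_mult (- 4 / alpha) p_infty).
      -- apply is_lim_scal_l, is_lim_id.
      -- assert (Hn : - 4 / alpha < 0).
         { replace (- 4 / alpha) with (- (4 / alpha)) by (field; lra).
           pose proof (Rdiv_lt_0_compat 4 alpha); lra. }
         simpl; destruct (Rle_dec 0 (- 4 / alpha)) as [H | _]; [| reflexivity].
         exfalso; exact (Rlt_not_le _ _ Hn H).
    * exists 0; intros y _; discriminate.
Qed.

(** The bracket on the right is the time that the flow needs to bring [B]
    from [y] down to [0].  It is at least of order [y ^ 2], because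
    [dt / dB = B / (8 * (B - 2 * alpha))] vanishes to first order at
    [B = 0].  After scaling, the claim is the inequality
    [- ln (1 - x) >= x + x ^ 2 / 2] at [x = y / (2 * alpha)], obtained from
    the sign of a derivative. *)
Lemma remaining_time_bound (alpha y : R) :
  0 < alpha -> 0 < y < 2 * alpha ->
  y ^ 2 <= 32 * alpha *
    (flow_time alpha (-1) (ln (2 * alpha)) -
     flow_time alpha (-1) (ln (2 * alpha - y))).
Proof.
intros Ha Hy.
set (c := 2 * alpha) in *.
destruct (MVT_gen (fun x => - c * ln (c - x) - x - x ^ 2 / (2 * c)) 0 y
  (fun x => c / (c - x) - 1 - x / c)) as [x [Hx E]].
- rewrite Rmin_left, Rmax_right by lra; intros x Hx.
  auto_derive; [lra | field; lra].
- rewrite Rmin_left, Rmax_right by lra; intros x Hx.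
  apply derivable_continuous_pt.
  exists (c / (c - x) - 1 - x / c); apply is_derive_Reals.
  auto_derive; [lra | field; lra].
- rewrite Rmin_left, Rmax_right in Hx by lra.
  assert (Hd : 0 <= c / (c - x) - 1 - x / c).
  { replace (c / (c - x) - 1 - x / c) with (x ^ 2 / (c * (c - x)))
      by (field; lra).
    apply Rcomplements.Rdiv_le_0_compat; [apply pow2_ge_0 |].
    apply Rmult_lt_0_compat; lra. }
  assert (Hp : 0 <= (c / (c - x) - 1 - x / c) * (y - 0))
    by (apply Rmult_le_pos; lra).
  rewrite <- E in Hp.
  replace (0 ^ 2 / (2 * c)) with 0 in Hp by (field; lra).
  replace (c - 0) with c in Hp by ring.
  unfold flow_time; rewrite !exp_ln by lra.
  fold c.
  replace (32 * alpha * ((c * ln c + -1 * c) / 8 -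
    (c * ln (c - y) + -1 * (c - y)) / 8))
    with (2 * c * (c * ln c - c * ln (c - y) - y)) by (unfold c; field).
  assert (Hq : y ^ 2 / (2 * c) <= c * ln c - c * ln (c - y) - y) by lra.
  replace (y ^ 2) with (2 * c * (y ^ 2 / (2 * c))) by (field; lra).
  apply Rmult_le_compat_l; lra.
Qed.

Lemma collapsing_case (alpha : R) (T : Rbar) (A B : R -> R) :
  0 < alpha -> Rbar_lt 0 T ->
  maximal_sol_rg2_solution alpha T A B ->
  B 0 < 2 * alpha ->
  exists T1 : R,
    T = Finite T1 /\
    filterlim A (at_left T1) (locally 0) /\
    filterlim B (at_left T1) (locally 0).
Proof.
intros Ha HT Hmax Hside.
assert (Hsg : -1 = 1 \/ -1 = -1) by (right; reflexivity).
assert (Hside1 : 0 < -1 * (B 0 - 2 * alpha)) by lra.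
pose proof (proj1 Hmax) as Hsol.
pose proof (flow_time_along_solution alpha (-1) T A B Hsg Hsol Hside1) as Htime.
pose proof (side_preserved alpha (-1) T A B Hsg Hsol Hside1) as Hst.
set (u0 := ln (-1 * (B 0 - 2 * alpha))) in *.
set (c := ln (2 * alpha)).
assert (Hexpc : exp c = 2 * alpha) by (apply exp_ln; lra).
(* [T1] is the time at which [u] reaches [ln (2 * alpha)], that is, [B]
   reaches [0]. *)
set (T1 := flow_time alpha (-1) c - flow_time alpha (-1) u0).
assert (Hbound : forall t, forward_interval T t ->
  0 < B t < 2 * alpha /\ B t ^ 2 <= 32 * alpha * (T1 - t)).
{ intros t Ht.
  specialize (Hst t Ht); destruct (Hsol t Ht) as [_ [Bpos _]].
  split; [lra |].
  unfold T1.
  replace (flow_time alpha (-1) c - flow_time alpha (-1) u0 - t)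
    with (flow_time alpha (-1) c - flow_time alpha (-1) (ln (2 * alpha - B t))).
  - apply remaining_time_bound; lra.
  - replace (2 * alpha - B t) with (-1 * (B t - 2 * alpha)) by ring.
    rewrite (Htime t Ht); ring. }
assert (Hupper : forall t, forward_interval T t -> t < T1).
{ intros t Ht; destruct (Hbound t Ht) as [Bt Ht1].
  assert (0 < B t ^ 2) by (apply pow_lt; lra).
  assert (0 < T1 - t); [| lra].
  apply Rmult_lt_reg_l with (32 * alpha); lra. }
(* At [u = ln (2 * alpha)] the condition [B > 0] fails, so the lower bound
   on the maximal time is used at points [b] just to the left of it. *)
assert (Hlower : forall s, s < T1 -> Rbar_le s T).
{ intros s Hs.
  assert (Hu0c : u0 < c).
  { apply ln_increasing; [exact Hside1 |].
    destruct (Hsol 0 (conj (Rle_refl 0) HT)) as [_ [B0pos _]]; lra. }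
  assert (Hcont : continuous (flow_time alpha (-1)) c).
  { apply (ex_derive_continuous (flow_time alpha (-1))).
    eexists; apply is_derive_flow_time. }
  assert (Heps : 0 < T1 - s) by lra.
  destruct (proj1 (filterlim_locally _ _) Hcont (mkposreal _ Heps)) as [d Hd].
  assert (Hb : exists b, u0 < b < c /\ Rabs (b - c) < d).
  { pose proof (cond_pos d) as Hdpos.
    pose proof (Rmin_l d (c - u0)); pose proof (Rmin_r d (c - u0)).
    assert (0 < Rmin d (c - u0)) by (apply Rmin_pos; lra).
    exists (c - Rmin d (c - u0) / 2).
    split; [lra |]; apply Rabs_def1; lra. }
  destruct Hb as [b [Hb Hbd]].
  assert (Hbs : Rabs (flow_time alpha (-1) b - flow_time alpha (-1) c)
                < T1 - s) by (apply (Hd b); exact Hbd).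
  apply Rabs_def2 in Hbs.
  apply Rbar_le_trans with
    (Finite (flow_time alpha (-1) b - flow_time alpha (-1) u0)).
  - simpl; unfold T1 in *; lra.
  - apply (maximal_time_lower_bound alpha (-1) T A B); try assumption.
    + apply Hb.
    + assert (exp b < exp c) by (apply exp_increasing; lra); lra. }
assert (ET : T = Finite T1).
{ destruct T as [T | |]; simpl in HT; [| | contradiction].
  - f_equal; apply Rle_antisym; apply Rnot_lt_le; intros Hlt.
    + pose proof (Hupper (Rmax 0 T1)) as H; pose proof (Rmax_r 0 T1).
      enough (Rmax 0 T1 < T1) by lra.
      apply H; split; [apply Rmax_l |]; simpl; apply Rmax_lub_lt; lra.
    + pose proof (Hlower ((T + T1) / 2)) as H; simpl in H.
      assert ((T + T1) / 2 <= T) by (apply H; lra); lra.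
  - exfalso; pose proof (Hupper (Rmax 0 T1)) as H; pose proof (Rmax_r 0 T1).
    enough (Rmax 0 T1 < T1) by lra.
    apply H; split; [apply Rmax_l | exact I]. }
exists T1; split; [exact ET |].
subst T; simpl in HT.
assert (HB : filterlim B (at_left T1) (locally 0)).
{ apply filterlim_locally; intros eps.
  pose proof (cond_pos eps) as Heps.
  assert (Hd : 0 < Rmin T1 (eps ^ 2 / (32 * alpha))).
  { apply Rmin_pos; [exact HT |].
    apply Rdiv_lt_0_compat; [apply pow_lt, Heps | lra]. }
  exists (mkposreal _ Hd); intros t Ht HtT; simpl in Ht.
  assert (Habs : Rabs (t - T1) < Rmin T1 (eps ^ 2 / (32 * alpha))) by exact Ht.
  apply Rabs_def2 in Habs.
  pose proof (Rmin_l T1 (eps ^ 2 / (32 * alpha))).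
  pose proof (Rmin_r T1 (eps ^ 2 / (32 * alpha))).
  destruct (Hbound t) as [Bt Bt2]; [split; simpl; lra |].
  change (Rabs (B t - 0) < eps).
  rewrite Rminus_0_r, Rabs_pos_eq by lra.
  apply Rnot_le_lt; intros Hle.
  assert (eps ^ 2 <= B t ^ 2) by (apply pow_incr; lra).
  assert (32 * alpha * (T1 - t) < 32 * alpha * (eps ^ 2 / (32 * alpha)))
    by (apply Rmult_lt_compat_l; lra).
  replace (32 * alpha * (eps ^ 2 / (32 * alpha))) with (eps ^ 2) in *
    by (field; lra).
  lra. }
split; [| exact HB].
set (k := A 0 * (1 - 2 * alpha / B 0)).
apply filterlim_ext_loc with (fun t => k * B t / (B t - 2 * alpha)).
- exists (mkposreal _ HT); intros t Ht HtT.
  assert (Habs : Rabs (t - T1) < T1) by exact Ht.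
  apply Rabs_def2 in Habs.
  assert (Hft : forward_interval T1 t) by (split; simpl; lra).
  destruct (Hbound t Hft) as [Bt _].
  unfold k; rewrite <- (first_integral alpha _ A B Hsol t Hft); field; lra.
- apply (filterlim_comp _ _ _ B (fun y => k * y / (y - 2 * alpha)) _ (locally 0));
    [exact HB |].
  assert (Hc : continuous (fun y => k * y / (y - 2 * alpha)) 0).
  { apply (ex_derive_continuous (fun y => k * y / (y - 2 * alpha))).
    auto_derive; lra. }
  unfold continuous in Hc.
  replace (k * 0 / (0 - 2 * alpha)) with 0 in Hc by (field; lra).
  exact Hc.
Qed.

Theorem theorem3 :
  forall (alpha : R) (A0 B0 : R) (tmax : Rbar) (A B : R -> R),
    0 < alpha ->
    0 < A0 -> 0 < B0 ->
    Rbar_lt (Finite 0) tmax ->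
    A 0 = A0 -> B 0 = B0 ->
    maximal_sol_rg2_solution alpha tmax A B ->
    (B0 > 2 * alpha ->
       tmax = p_infty /\
       is_lim B p_infty p_infty /\
       is_lim A p_infty (Finite (A0 * (1 - 2 * alpha / B0)))) /\
    (B0 = 2 * alpha ->
       tmax = p_infty /\
       (forall t : R, 0 < t -> B t = 2 * alpha) /\
       is_lim A p_infty (Finite 0)) /\
    (B0 < 2 * alpha ->
       exists T : R,
         tmax = Finite T /\
         filterlim A (at_left T) (locally 0) /\
         filterlim B (at_left T) (locally 0)).
Proof.
intros alpha A0 B0 tmax A B Ha _ _ HT <- <- Hmax.
split; [| split]; intros HB0.
- apply expanding_case; assumption.
- apply stationary_case; assumption.
- apply (collapsing_case alpha); assumption.
Qed.
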